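(* Let $f:M\to M$ be a continuous map on a compact, finite-dimensional manifold $M$, and let $\Phi=\{\phi_n\}_{n\ge 1}$ be a subadditive potential on $M$. Assume that there exists a strong observable measure $\mu$ for $f$. If the growth rates of $\Phi$ satisfy $$\Phi^*(x):=\lim_{n\to\infty}\frac1n\phi_n(x)<0\quad\text{for }\mu\text{-a.e. }x\in M,$$ then $\widetilde\Phi^*(x)<0$ on a set of points $x$ with positive Lebesgue measure.
   Context: Lebesgue measure means a normalized Lebesgue measure $m$ on $M$. $\mathcal M$ denotes the set of all Borel probability measures on $M$ with the weak$^*$ topology, and $\mathrm{dist}^*$ is a fixed metric on $\mathcal M$ inducing this topology. $\mathcal N_\epsilon(\mu)$ is the $\epsilon$-neighborhood of $\mu\in\mathcal M$ in the metric $\mathrm{dist}^*$. For $x\in M$, the empirical measures are $\delta_{x,n}=\frac1n\sum_{j=0}^{n-1}\delta_{f^j(x)}$, where $\delta_y$ is the Dirac measure at $y$. $\mathcal V_f(x)$ is the set of all weak$^*$ limits of convergent subsequences of $(\delta_{x,n})_{n\ge1}$. A measure $\mu\in\mathcal M$ is strong observable for $f$ if for all $\epsilon>0$ the set $\mathcal S_\epsilon(\mu)=\{x\in M:\mathcal V_f(x)\subset\mathcal N_\epsilon(\mu)\}$ has positive Lebesgue measure. (Strong observable measures are $f$-invariant.) A subadditive potential on $M$ is a sequence $\Phi=\{\phi_n\}_{n\ge1}$ of continuous real functions on $M$ with $\phi_{n+m}(x)\le\phi_n(x)+\phi_m(f^n x)$ for all $x\in M$ and $n,m\in\mathbb N$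 (positive integers). By Kingman's subadditive ergodic theorem the limit $\Phi^*(x)$ exists (possibly $-\infty$) for $\mu$-a.e. $x$, for every $f$-invariant probability $\mu$. The largest growth rate at any $x\in M$ is $\widetilde\Phi^*(x):=\limsup_{n\to\infty}\frac1n\phi_n(x)$. *)

(* Defs.v *)
From HB Require Import structures.
From mathcomp Require Import all_boot all_order all_algebra.
From mathcomp Require Import all_classical all_reals all_analysis.

Set Implicit Arguments.
Unset Strict Implicit.
Unset Printing Implicit Defensive.

Import Order.TTheory GRing.Theory Num.Theory.
Import numFieldNormedType.Exports.

Local Open Scope classical_set_scope.
Local Open Scope ring_scope.

Section power_measure_succ.
Local Open Scope ereal_scope.
Context (d : measure_display) (T : measurableType d) (R : realType) (n : nat).
Variables (lam : {sigma_finite_measure set T -> \bar R}).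
Variables (mu : {sigma_finite_measure set (n.-tuple T) -> \bar R}).

Definition tuple_cons (p : T * n.-tuple T) : n.+1.-tuple T :=
  [the n.+1.-tuple T of p.1 :: p.2].

Definition power_measure_succ : set (n.+1.-tuple T) -> \bar R :=
  pushforward (lam \x mu) tuple_cons.

Let measurable_tuple_cons : measurable_fun [set: T * n.-tuple T] tuple_cons.
Proof. exact: (measurable_cons measurable_fst measurable_snd). Qed.

Let pms0 : power_measure_succ set0 = 0.
Proof. by rewrite /power_measure_succ /pushforward preimage_set0 measure0. Qed.

Let pms_ge0 A : 0 <= power_measure_succ A.
Proof. exact: measure_ge0. Qed.

Let pms_sigma_additive : semi_sigma_additive power_measure_succ.
Proof.
move=> F mF tF mUF; rewrite /power_measure_succ /pushforward preimage_bigcup.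
apply: measure_semi_sigma_additive.
- by move=> i; rewrite -[X in measurable X]setTI; exact: measurable_tuple_cons.
- apply/trivIsetP => /= i j _ _ ij; rewrite -preimage_setI.
  by move/trivIsetP : tF => /(_ _ _ _ _ ij) ->//; rewrite preimage_set0.
- by rewrite -preimage_bigcup -[X in measurable X]setTI;
    exact: measurable_tuple_cons.
Qed.

HB.instance Definition _ :=
  isMeasure.Build _ _ _ power_measure_succ pms0 pms_ge0 pms_sigma_additive.

Let pms_sigma_finite : sigma_finite setT power_measure_succ.
Proof.
have /sigma_finiteP[F [TF ndF Foo]] := sigma_finiteT lam.
have /sigma_finiteP[G [TG ndG Goo]] := sigma_finiteT mu.
pose g (t : n.+1.-tuple T) : T * n.-tuple T := (thead t, [tuple of behead t]).
have mg : measurable_fun setT g.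
  apply/measurable_fun_pair; [exact: measurable_tnth|exact: measurable_behead].
have gK p : g (tuple_cons p) = p.
  by case: p => x t; rewrite /g theadE; congr pair; exact: val_inj.
exists (fun i => g @^-1` (F i `*` G i)).
  apply/seteqP; split => // t _.
  have [i _ Fi] : (\bigcup_i F i) (g t).1 by rewrite -TF.
  have [j _ Gj] : (\bigcup_i G i) (g t).2 by rewrite -TG.
  exists (maxn i j) => //; split.
    by move: Fi; exact/subsetPset/ndF/leq_maxl.
  by move: Gj; exact/subsetPset/ndG/leq_maxr.
move=> i; have [mF Fioo] := Foo i; have [mG Gioo] := Goo i; split.
  by rewrite -[X in measurable X]setTI; apply: mg => //; exact: measurableX.
rewrite /power_measure_succ /pushforward.
rewrite (_ : _ @^-1` _ = F i `*` G i); last first.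
  by apply/funext => p; rewrite /preimage /mkset gK.
by rewrite product_measure1E// lte_mul_pinfty// ge0_fin_numE.
Qed.

HB.instance Definition _ :=
  Measure_isSigmaFinite.Build _ _ _ power_measure_succ pms_sigma_finite.

End power_measure_succ.

(* The n-fold product of [lam] with itself. *)
Fixpoint power_measure (d : measure_display) (T : measurableType d)
    (R : realType) (lam : {sigma_finite_measure set T -> \bar R}) (n : nat) :
    {sigma_finite_measure set (n.-tuple T) -> \bar R} :=
  match n with
  | 0 => @dirac _ (0.-tuple T) [tuple] R
  | n'.+1 => power_measure_succ lam (power_measure lam n')
  end.

Definition lebesgue_Rn (R : realType) (n : nat) :
    {sigma_finite_measure set (n.-tuple (measurableTypeR R)) -> \bar R} :=
  power_measure (@lebesgue_measure R) n.

Definition row_of_tuple (R : realType) (n : nat)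
    (t : n.-tuple (measurableTypeR R)) : 'rV[R]_n := \row_i tnth t i.

Definition C1_on (R : realType) (n p : nat) (W : set 'rV[R]_n)
    (g : 'rV[R]_n -> 'rV[R]_p) :=
  (forall x, W x -> differentiable g x) /\
  (forall v, {within W, continuous (fun x => 'd g x v)}).

(* [chart_map] matters only on [chart_dom], [chart_inv] only on [chart_codom]. *)
Record chart (R : realType) (n : nat) (M : Type) := Chart {
  chart_dom : set M ;
  chart_map : M -> 'rV[R]_n ;
  chart_inv : 'rV[R]_n -> M }.

Definition chart_codom (R : realType) (n : nat) (M : Type) (c : chart R n M) :
  set 'rV[R]_n := chart_map c @` chart_dom c.

Definition is_chart (R : realType) (n : nat) (M : topologicalType)
    (c : chart R n M) :=
  [/\ open (chart_dom c), open (chart_codom c),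
      (forall x, chart_dom c x -> chart_inv c (chart_map c x) = x),
      {within chart_dom c, continuous (chart_map c)} &
      {within chart_codom c, continuous (chart_inv c)}].

Definition C1_compatible (R : realType) (n : nat) (M : Type)
    (c c' : chart R n M) :=
  C1_on (chart_map c @` (chart_dom c `&` chart_dom c'))
    (chart_map c' \o chart_inv c).

(* Manifold without boundary. Class C^1 makes the Lebesgue measure class
   independent of the chart. *)
Definition is_manifold (R : realType) (n : nat) (M : topologicalType)
    (atlas : set (chart R n M)) :=
  [/\ hausdorff_space M, @second_countable M,
      (forall c, atlas c -> is_chart c),
      (forall x : M, exists2 c, atlas c & chart_dom c x) &
      (forall c c', atlas c -> atlas c' -> C1_compatible c c')].

Notation borel M := (g_sigma_algebraType (@open M)).

(* A normalized Lebesgue measure: a probability measure with a continuous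
   positive density in every chart, as the normalized volume of any Riemannian
   metric. *)
Definition is_normalized_lebesgue (R : realType) (n : nat)
    (M : ptopologicalType) (atlas : set (chart R n M))
    (m : probability (borel M) R) :=
  forall c, atlas c -> exists rho : 'rV[R]_n -> R,
    [/\ {within chart_codom c, continuous rho},
        (forall y, chart_codom c y -> 0 < rho y) &
        (forall A : set (borel M), measurable A -> A `<=` chart_dom c ->
          m A = \int[lebesgue_Rn R n]_(t in @row_of_tuple R n @^-1`
                                            (chart_map c @` A))
                  (rho (row_of_tuple t))%:E)%E].

Section weak_star.
Context (R : realType) (M : ptopologicalType).

Definition test_integrals (mu : probability (borel M) R) :
    {ptws continuousType M R -> R} :=
  fun phi => \int[mu]_x phi x.

Definition weak_star := initial_topology test_integrals.

(* [probability] records may differ on non-measurable sets, so equality of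
   measures is expressed on Borel sets. *)
Definition is_weak_star_metric
    (dist : probability (borel M) R -> probability (borel M) R -> R) :=
  [/\ (forall mu nu, dist mu nu = 0 <->
         forall A : set (borel M), measurable A -> mu A = nu A),
      (forall mu nu, dist mu nu = dist nu mu),
      (forall mu nu xi, dist mu xi <= dist mu nu + dist nu xi) &
      (forall (mu : weak_star) (U : set weak_star),
         nbhs mu U <->
         exists2 e : R, 0 < e & [set nu | dist mu nu < e] `<=` U)].

End weak_star.

Section empirical.
Context (R : realType) (M : ptopologicalType) (f : M -> M).

(* [empirical x n] averages over the first [n.+1] points of the orbit. *)
Definition empirical (x : M) (n : nat) : set (borel M) -> \bar R :=
  mscale (n.+1%:R^-1)%:nng
    (msum (fun j => @dirac _ (borel M) (iter j f x) R) n.+1).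

HB.instance Definition _ x n := Measure.on (empirical x n).

Lemma empirical_setT x n : empirical x n setT = 1%E.
Proof.
have sum1 : (\sum_(j < n.+1) @dirac _ (borel M) (iter j f x) R setT)%E =
    n.+1%:R%:E.
  rewrite (eq_bigr (fun=> 1%E)) => [|j _]; last exact: diracT.
  by rewrite sumEFin big_const_ord iter_addr_0.
have -> : empirical x n setT = ((n.+1%:R^-1)%:E * n.+1%:R%:E)%E.
  by rewrite -sum1.
by rewrite -EFinM mulVf.
Qed.

HB.instance Definition _ x n :=
  Measure_isProbability.Build _ _ _ (empirical x n) (empirical_setT x n).

Definition limit_measures (x : M) : set (probability (borel M) R) :=
  [set nu | exists2 s : nat -> nat, {homo s : i j / (i < j)%N} &
    (fun k => (empirical x (s k) : probability (borel M) R) : weak_star R M)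
      @ \oo --> (nu : weak_star R M)].

Definition observation_set
    (dist : probability (borel M) R -> probability (borel M) R -> R)
    (mu : probability (borel M) R) (e : R) : set (borel M) :=
  [set x | limit_measures x `<=` [set nu | dist mu nu < e]].

Definition strong_observable
    (dist : probability (borel M) R -> probability (borel M) R -> R)
    (m mu : probability (borel M) R) :=
  forall e : R, 0 < e -> (0 < m (observation_set dist mu e))%E.

End empirical.

(* Indexed by positive integers: [phi 0] is irrelevant. *)
Definition subadditive_potential (R : realType) (M : topologicalType)
    (f : M -> M) (phi : nat -> M -> R) :=
  (forall n, (0 < n)%N -> continuous (phi n)) /\
  (forall n p x, (0 < n)%N -> (0 < p)%N ->
     phi (n + p)%N x <= phi n x + phi p (iter n f x)).

Definition growth (R : realType) (M : Type) (phi : nat -> M -> R)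
    (x : M) : (\bar R)^nat := fun n => (phi n x / n%:R)%:E.

Definition largest_growth_rate (R : realType) (M : Type)
    (phi : nat -> M -> R) (x : M) : \bar R := limn_esup (growth phi x).

(* Main.v *)
(* By the reverse Fatou lemma the hypothesis gives an N with a negative mu-mean
   of phi_N, and then phi_N has mean less than some -c < 0 for all measures in a
   weak* ball around mu. If all limit measures of x lie in that ball, its
   empirical measures eventually lie there too, because the space of
   probability measures is weak* sequentially compact. The Birkhoff sums of
   phi_N along the orbit of x are then eventually at most -c n, and subadditivity
   transfers this to phi_n. The same compactness argument shows that the set of
   such x is Borel, so that its positive measure bounds the measure of the
   conclusion from below.
   Compactness: an ultrafilter limit of the integration functionals is a positive
   functional, which is integration against a measure by the Riesz
   representation theorem, proved here through the Daniell upper integral. *)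

Require Import Defs.
From HB Require Import structures.
From mathcomp Require Import all_boot all_order all_algebra.
From mathcomp Require Import all_classical all_reals all_analysis.
From mathcomp Require Import measurable_realfun ring lra.

Set Implicit Arguments.
Unset Strict Implicit.
Unset Printing Implicit Defensive.

Import Order.TTheory GRing.Theory Num.Theory.
Import numFieldNormedType.Exports.

Local Open Scope classical_set_scope.
Local Open Scope ring_scope.

Definition positive_functional (R : realType) (T : topologicalType)
    (L : (T -> R) -> R) :=
  [/\ forall f g : T -> R, continuous f -> continuous g -> L (f \+ g) = L f + L g,
      forall c (f : T -> R), continuous f -> L (fun x => c * f x) = c * L f,
      forall f : T -> R, continuous f -> (forall x, 0 <= f x) -> 0 <= L f &
      L (fun=> 1) = 1].

Section positive_functional_theory.
Context (R : realType) (T : topologicalType) (L : (T -> R) -> R).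
Implicit Types (f g : T -> R) (F G : T -> \bar R).
Hypothesis posL : positive_functional L.

Lemma functionalD f g : continuous f -> continuous g ->
  L (fun x => f x + g x) = L f + L g.
Proof. by case: posL => + _ _ _; exact. Qed.

Lemma functionalZ c f : continuous f -> L (fun x => c * f x) = c * L f.
Proof. by case: posL => _ + _ _; exact. Qed.

Lemma functional_ge0 f : continuous f -> (forall x, 0 <= f x) -> 0 <= L f.
Proof. by case: posL => _ _ + _; exact. Qed.

Lemma functional_cst c : L (fun=> c) = c.
Proof.
have [_ _ _ L1] := posL.
have := functionalZ c (f := fun=> 1) (fun x => cvg_cst _).
by rewrite L1 mulr1 => Lc; rewrite -[RHS]Lc; congr (L _); apply/funext => x; rewrite /= mulr1.
Qed.

Lemma functionalB f g : continuous f -> continuous g ->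
  L (fun x => f x - g x) = L f - L g.
Proof.
move=> cf cg; rewrite functionalD//; last by move=> x; apply: cvgN; exact: cg.
rewrite -(mulN1r (L g)) -functionalZ//; congr (_ + L _).
by apply/funext => x; rewrite mulN1r.
Qed.

Lemma le_functional f g : continuous f -> continuous g ->
  (forall x, f x <= g x) -> L f <= L g.
Proof.
move=> cf cg fg; rewrite -subr_ge0 -functionalB//; apply: functional_ge0.
  by move=> x; apply: cvgB; [exact: cg|exact: cf].
by move=> x; rewrite subr_ge0.
Qed.

Lemma continuous_fsum n (g : nat -> T -> R) :
  (forall k, continuous (g k)) -> continuous (fun x => \sum_(k < n) g k x).
Proof.
move=> cg; elim: n => [|n IH].
  by under eq_fun do rewrite big_ord0; move=> x; exact: cvg_cst.
under eq_fun do rewrite big_ord_recr/=.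
by move=> x; apply: cvgD; [exact: IH|exact: cg].
Qed.

Lemma functional_sum n (g : nat -> T -> R) : (forall k, continuous (g k)) ->
  L (fun x => \sum_(k < n) g k x) = \sum_(k < n) L (g k).
Proof.
move=> cg; elim: n => [|n IH].
  by under eq_fun do rewrite big_ord0; rewrite big_ord0 functional_cst.
under eq_fun do rewrite big_ord_recr/=.
by rewrite functionalD ?IH ?big_ord_recr//; exact: continuous_fsum.
Qed.

Local Open Scope ereal_scope.

Definition upper_cover (F : T -> \bar R) : set (nat -> T -> R) :=
  [set g : nat -> T -> R | [/\ forall k, continuous (g k), forall k x, (0 <= g k x)%R &
               forall x, F x <= \sum_(k <oo) (g k x)%:E]].

Definition upper_integral (F : T -> \bar R) : \bar R :=
  ereal_inf [set \sum_(k <oo) (L (g k))%:E | g in upper_cover F].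

Lemma upper_integral_ge0 F : 0 <= upper_integral F.
Proof.
apply: le_ereal_inf_tmp => _ [g [cg g0 _] <-].
by apply: nneseries_ge0 => k _ _; rewrite lee_fin functional_ge0.
Qed.

Lemma le_upper_integral F G : (forall x, F x <= G x) ->
  upper_integral F <= upper_integral G.
Proof.
move=> FG; apply: ereal_inf_le_tmp => _ [g [cg g0 Gg] <-]; exists g => //.
by split=> // x; exact: le_trans (FG x) (Gg x).
Qed.

Lemma upper_integral_series (F : nat -> T -> \bar R) :
  (forall n x, 0 <= F n x) ->
  upper_integral (fun x => \sum_(n <oo) F n x) <=
    \sum_(n <oo) upper_integral (F n).
Proof.
move=> F0; have [[i ioo]|] := pselect (exists i, upper_integral (F i) = +oo).
  rewrite (eseries_pinfty _ _ ioo) ?leey// => n _.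
  by rewrite -ltNye (lt_le_trans _ (upper_integral_ge0 _)).
rewrite -forallNE => Foo.
suff add2e (e : {posnum R}) : upper_integral (fun x => \sum_(n <oo) F n x) <=
    \sum_(n <oo) upper_integral (F n) + e%:num%:E.
  by apply/lee_addgt0Pr => _/posnumP[].
rewrite (le_trans _ (epsilon_trick _ _ _))//; last first.
  by move=> n; exact: upper_integral_ge0.
pose P n (g : nat -> T -> R) := upper_cover (F n) g /\ \sum_(k <oo) (L (g k))%:E
  <= upper_integral (F n) + (e%:num / (2 ^ n.+1)%:R)%:E.
have [G PG] : {G : nat -> nat -> T -> R & forall n, P n (G n)}.
  apply: (@choice _ _ P) => n; have en : (0 < e%:num / (2 ^ n.+1)%:R :> R)%R.
    by [].
  have fin : upper_integral (F n) \is a fin_num.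
    by rewrite ge0_fin_numE ?upper_integral_ge0// ltey; exact/eqP/Foo.
  have [_ [g Fg <-]] := lb_ereal_inf_adherent en fin.
  by move=> /ltW gle; exists g; split.
have G0 n k x : (0 <= G n k x)%R by have [[]] := PG n.
have cG n k : continuous (G n k) by have [[]] := PG n.
have /card_esym/ppcard_eqP[s] := card_nat2.
pose h k := G (s k).1 (s k).2.
have sumh (a : nat -> nat -> \bar R) : (forall i j, 0 <= a i j) ->
    \sum_(k <oo) a (s k).1 (s k).2 = \sum_(n <oo) \sum_(k <oo) a n k.
  move=> a0; rewrite nneseries_esumT// -(@reindex_esum _ _ _ setT setT s
    (fun p => a p.1 p.2)) //.
  rewrite nneseries_esumT; last by move=> n; exact: nneseries_ge0.
  rewrite (eq_esum (b := fun n => \esum_(k in setT) a n k)); last first.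
    by move=> n _; rewrite nneseries_esumT.
  by rewrite esum_esum//; congr esum; apply/seteqP.
apply: (@le_trans _ _ (\sum_(n <oo) \sum_(k <oo) (L (G n k))%:E)).
  rewrite -(sumh (fun n k => (L (G n k))%:E)); last first.
    by move=> i j; rewrite lee_fin functional_ge0.
  apply: ereal_inf_lbound; exists h => //; split => [k|k x|x].
  - exact: cG.
  - exact: G0.
  - rewrite (sumh (fun n k => (G n k x)%:E)); last by move=> i j; rewrite lee_fin.
    apply: lee_nneseries => [n _ _|n _]; first exact: F0.
    by have [[_ _]] := PG n.
apply: lee_nneseries => [n _ _|n _]; last by have [] := PG n.
by apply: nneseries_ge0 => k _ _; rewrite lee_fin functional_ge0.
Qed.

Lemma series_head (a : \bar R) :
  \sum_(k <oo) (if k is 0%N then a else 0) = a.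
Proof.
apply/cvg_lim => //; rewrite -cvg_shiftS.
rewrite (_ : [sequence _]_n = cst a); first exact: cvg_cst.
by rewrite funeqE => n /=; rewrite big_nat_recl//= big1 ?adde0.
Qed.

Lemma upper_integral_le f : continuous f -> (forall x, (0 <= f x)%R) ->
  upper_integral (EFin \o f) <= (L f)%:E.
Proof.
move=> cf f0; apply: ereal_inf_lbound.
exists (fun k => if k is 0%N then f else fun=> 0%R); last first.
  rewrite -[RHS]series_head; apply: eq_eseriesr => -[|k] _//.
  by rewrite functional_cst.
split => [[|k]//|[|k]//|x].
  by move=> x; exact: cvg_cst.
rewrite -[leLHS]series_head; apply: lee_nneseries => -[|k]//= _ _.
by rewrite lee_fin.
Qed.

Hypothesis compactT : compact [set: T].

(* Dini: the strict inequality f < g_0 + ... + g_(n-1) + e holds everywhere for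
   some n, by compactness. *)
Lemma upper_integral_ge f : continuous f ->
  (L f)%:E <= upper_integral (EFin \o f).
Proof.
move=> cf; apply: le_ereal_inf_tmp => _ [g [cg g0 fg] <-].
apply/lee_addgt0Pr => e e0.
have [n fn] : exists n, forall x, (f x < \sum_(k < n) g k x + e)%R.
  have /compact_near_coveringP/(_ nat \oo
    (fun n x => (f x < \sum_(k < n) g k x + e)%R) _) := compactT.
  case=> [x _|n _ /(_ n (leqnn n)) fn]; last by exists n => x; exact: fn.
  have [n fxn] : exists n, (f x < \sum_(k < n) g k x + e)%R.
    have : (f x)%:E < \sum_(k <oo) (g k x)%:E + e%:E.
      have [->|fin] := eqVneq (\sum_(k <oo) (g k x)%:E) +oo.
        by rewrite addye// ltry.
      apply: le_lt_trans (fg x) _; rewrite lteDl// ge0_fin_numE ?ltey//.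
      by apply: nneseries_ge0 => k _ _; rewrite lee_fin.
    rewrite -lteBlDr//.
    have /ereal_nondecreasing_cvgn/cvg_lim ->// : nondecreasing_seq
        (fun n => \sum_(0 <= k < n) (g k x)%:E).
      move=> a b ab; apply: lee_sum_nneg_natr => // k _ _.
      by rewrite lee_fin.
    move=> /ereal_sup_gt[_ [n _ <-]].
    by rewrite lteBlDr// big_mkord sumEFin -EFinD lte_fin => ?; exists n.
  have : \forall y \near x, (f y < \sum_(k < n) g k y + e)%R.
    have : \forall y \near x, (0 < \sum_(k < n) g k y + e - f y)%R.
      have /cvgr_gt : (fun y => \sum_(k < n) g k y + e - f y)%R @ x -->
          (\sum_(k < n) g k x + e - f x)%R.
        apply: cvgB; last exact: cf.
        by apply: cvgD; [exact: continuous_fsum|exact: cvg_cst].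
      by apply; rewrite subr_gt0.
    by apply: filterS => y; rewrite subr_gt0.
  move=> nx; exists ([set y | (f y < \sum_(k < n) g k y + e)%R],
    [set m | (n <= m)%N]); first by split => //; exact: nbhs_infty_ge.
  move=> [y m] [/= fy nm]; apply: (lt_le_trans fy).
  rewrite lerD2r -!(big_mkord xpredT (fun k => g k y)).
  rewrite [leRHS](big_cat_nat (n := n))//=.
  by rewrite lerDl sumr_ge0.
have Lfn : (L f <= \sum_(k < n) L (g k) + e)%R.
  rewrite -functional_sum// -[X in (_ + X)%R]functional_cst -functionalD.
  - apply: le_functional => // [x|x]; last exact/ltW.
    by apply: cvgD; [exact: continuous_fsum|exact: cvg_cst].
  - exact: continuous_fsum.
  - by move=> x; exact: cvg_cst.
apply: (@le_trans _ _ (\sum_(k < n) (L (g k))%:E + e%:E)).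
  by rewrite sumEFin -EFinD lee_fin.
rewrite leeD2r// -(big_mkord xpredT (fun k => (L (g k))%:E)).
by apply: nneseries_lim_ge => k _; rewrite lee_fin functional_ge0.
Qed.

End positive_functional_theory.

Section outer_measure_of_functional.
Context (R : realType) (T : ptopologicalType) (L : (T -> R) -> R).
Implicit Types (f g h : T -> R) (A X : set T).
Hypothesis posL : positive_functional L.
Local Open Scope ereal_scope.

Definition functional_outer A : \bar R :=
  upper_integral L (fun x => (\1_A x)%:E).

Let outer0 : functional_outer set0 = 0.
Proof.
apply/eqP; rewrite eq_le upper_integral_ge0// andbT.
have := @upper_integral_le _ _ _ posL (fun=> 0%R) (@cst_continuous _ _ _).
move=> /(_ (fun=> lexx _)); rewrite functional_cst//.
congr (upper_integral _ _ <= _).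
by apply/funext => x /=; rewrite indic0.
Qed.

Let le_outer : {homo functional_outer : A B / A `<=` B >-> A <= B}.
Proof.
move=> A B AB; apply: le_upper_integral => x; rewrite lee_fin !indicE.
by case: (boolP (x \in A)) => //= /set_mem/AB/mem_set ->.
Qed.

Let outer_sigma_subadditive : sigma_subadditive functional_outer.
Proof.
move=> F; apply: le_trans (upper_integral_series posL _); last first.
  by move=> n x; rewrite lee_fin.
apply: le_upper_integral => x.
have [[n _ Fnx]|nF] := pselect ((\bigcup_n F n) x); last first.
  rewrite indicE memNset//; apply: nneseries_ge0 => n _ _.
  by rewrite lee_fin.
rewrite indicE mem_set; last by exists n.
apply: le_trans (nneseries_lim_ge n.+1 _) => [|k _]; last by rewrite lee_fin.
rewrite big_nat_recr//= indicE mem_set// -[leLHS]add0e leeD2r//.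
by apply: sume_ge0 => k _; rewrite lee_fin.
Qed.

Definition functional_outer_measure : {outer_measure set T -> \bar R} :=
  HB.pack functional_outer
    (isOuterMeasure.Build R T functional_outer outer0
      (fun A => upper_integral_ge0 posL _) le_outer outer_sigma_subadditive).

Lemma upper_integral_le_series (F : T -> \bar R) (g : nat -> T -> R) :
  upper_cover F g -> upper_integral L F <= \sum_(k <oo) (L (g k))%:E.
Proof. by move=> Fg; apply: ereal_inf_lbound; exists g. Qed.

(* With h_n = min(1, n h), a cover g of X splits into the cover (1 - h_n) g of
   X \ {h > 0} and, telescoping, the cover (h_(n+1) - h_n) g of X & {h > 0}. *)
Lemma cozero_caratheodory h : continuous h ->
  functional_outer_measure.-caratheodory [set x | (0 < h x)%R].
Proof.
move=> ch; apply: le_caratheodory_measurable => X.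
pose H n x : R := Num.min 1%R (n%:R * Num.max (h x) 0)%R.
have cH n : continuous (H n).
  move=> x; apply: (@continuous_min _ _ (fun=> 1%R)
    (fun x => n%:R * Num.max (h x) 0)%R); first exact: cvg_cst.
  apply: cvgM; first exact: cvg_cst.
  apply: (@continuous_max _ _ h (fun=> 0%R)); first exact: ch.
  exact: cvg_cst.
have H0 x : H 0%N x = 0%R by rewrite /H mul0r min_r.
have H_ge0 n x : (0 <= H n x)%R by rewrite /H le_min ler01/= mulr_ge0// le_max lexx orbT.
have H_le1 n x : (H n x <= 1)%R by rewrite /H ge_min lexx.
have Hnd n x : (H n x <= H n.+1 x)%R.
  rewrite /H le_min ge_min lexx/= ge_min; apply/orP; right.
  by rewrite ler_wpM2r ?ler_nat// le_max lexx orbT.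
have HN x : ~ (0 < h x)%R -> forall n, H n x = 0%R.
  move=> /negP; rewrite -leNgt => hx n.
  by rewrite /H [Num.max _ _]max_r// mulr0 min_r.
have HP x : (0 < h x)%R -> exists n, H n x = 1%R.
  move=> hx; exists (Num.bound (1 / h x)%R).
  rewrite /H [Num.max _ _]max_l ?ltW// min_l//.
  by rewrite -ler_pdivrMr//; apply/ltW/archi_boundP; exact/ltW/divr_gt0.
have -> : functional_outer_measure X =
  upper_integral L (fun x => (\1_X x)%:E) by [].
apply: le_ereal_inf_tmp => _ [g [cg g0 Xg] <-].
have cM (u v : T -> R) : continuous u -> continuous v ->
    continuous (fun x => u x * v x)%R.
  by move=> cu cv x; apply: cvgM; [exact: cu|exact: cv].
have cB (u v : T -> R) : continuous u -> continuous v ->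
    continuous (fun x => u x - v x)%R.
  by move=> cu cv x; apply: cvgB; [exact: cu|exact: cv].
have c1H n : continuous (fun x => 1 - H n x)%R.
  by apply: cB => //; exact: cst_continuous.
pose inner n k x := (H n x * g k x)%R.
pose outer n k x := ((1 - H n x) * g k x)%R.
pose diff n k x := ((H n.+1 x - H n x) * g k x)%R.
have ci n k : continuous (inner n k) by exact: cM.
have co n k : continuous (outer n k) by exact: cM.
have cd n k : continuous (diff n k) by apply: cM => //; exact: cB.
have inner0 n k x : (0 <= inner n k x)%R by rewrite mulr_ge0.
have outer0' n k x : (0 <= outer n k x)%R by rewrite mulr_ge0// subr_ge0.
have diff0 n k x : (0 <= diff n k x)%R by rewrite mulr_ge0// subr_ge0.
have Li0 n k : 0 <= (L (inner n k))%:E by rewrite lee_fin functional_ge0.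
have Lo0 n k : 0 <= (L (outer n k))%:E by rewrite lee_fin functional_ge0.
have Ld0 n k : 0 <= (L (diff n k))%:E by rewrite lee_fin functional_ge0.
have split_g n : \sum_(k <oo) (L (g k))%:E =
    \sum_(k <oo) (L (inner n k))%:E + \sum_(k <oo) (L (outer n k))%:E.
  rewrite -nneseriesD//; apply: eq_eseriesr => k _.
  rewrite -EFinD -(functionalD posL)//; congr (L _)%:E.
  by apply/funext => x; rewrite /inner /outer; ring.
have diffE (N k : nat) x : (\sum_(n < N) diff n k x = inner N k x)%R.
  rewrite -big_distrl/= -(big_mkord xpredT (fun n => H n.+1 x - H n x)%R).
  by rewrite telescope_sumr// H0 subr0.
have sum_diff N :
    \sum_(n < N) \sum_(k <oo) (L (diff n k))%:E = \sum_(k <oo) (L (inner N k))%:E.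
  rewrite -nneseries_sum//; apply: eq_eseriesr => k _.
  rewrite sumEFin -(functional_sum posL N (g := diff^~ k))//; congr (L _)%:E.
  by apply/funext => x; exact: diffE.
have mu_out n : functional_outer_measure (X `&` ~` [set x | (0 < h x)%R]) <=
    \sum_(k <oo) (L (outer n k))%:E.
  apply: upper_integral_le_series; split => // x.
  have [[Xx nhx]|nX] := pselect ((X `&` ~` [set x | (0 < h x)%R]) x).
    rewrite indicE mem_set//; have := Xg x; rewrite indicE mem_set//.
    move=> /le_trans; apply; apply: lee_nneseries => k _.
      by rewrite lee_fin.
    by rewrite /outer HN// subr0 mul1r.
  by rewrite indicE memNset//; apply: nneseries_ge0 => k _ _; rewrite lee_fin.
have mu_in : functional_outer_measure (X `&` [set x | (0 < h x)%R]) <=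
    \sum_(n <oo) \sum_(k <oo) (L (diff n k))%:E.
  pose F n x := \sum_(k <oo) (diff n k x)%:E.
  have F0 n x : 0 <= F n x by apply: nneseries_ge0 => k _ _; rewrite lee_fin.
  apply: (@le_trans _ _ (\sum_(n <oo) upper_integral L (F n))).
    apply: le_trans (upper_integral_series posL F0).
    apply: le_upper_integral => x.
    have [[Xx hx]|nX] := pselect ((X `&` [set x | (0 < h x)%R]) x); last first.
      by rewrite indicE memNset//; exact: nneseries_ge0.
    have [N HN1] := HP _ hx.
    apply: le_trans (nneseries_lim_ge N _) => //.
    rewrite big_mkord -nneseries_sum; last by move=> *; rewrite lee_fin.
    have := Xg x; rewrite !indicE !mem_set// => /le_trans; apply.
    apply: lee_nneseries => [k _ _|k _]; first by rewrite lee_fin.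
    by rewrite sumEFin diffE /inner HN1 mul1r.
  apply: lee_nneseries => [n _ _|n _]; first exact: upper_integral_ge0.
  by apply: upper_integral_le_series; split.
have [Soo|Soo] := eqVneq (\sum_(k <oo) (L (g k))%:E) +oo.
  by rewrite Soo leey.
have oX_fin : functional_outer_measure (X `&` ~` [set x | (0 < h x)%R])
    \is a fin_num.
  rewrite ge0_fin_numE; last exact: outer_measure_ge0.
  apply: le_lt_trans (mu_out 0%N) _; rewrite ltey; apply: contra_neq Soo => e.
  by rewrite (split_g 0%N) e addey// gt_eqF// (lt_le_trans ltNy0)// nneseries_ge0.
rewrite -leeBrDr//; apply: le_trans mu_in _; apply: lime_le.
  by apply: is_cvg_nneseries => n _ _; exact: nneseries_ge0.
near=> N; rewrite big_mkord sum_diff leeBrDr// (split_g N).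
by rewrite leeD2l.
Unshelve. all: by end_near. Qed.

End outer_measure_of_functional.

Section borel_of_cozero.
Context (R : realType) (M : ptopologicalType).

Lemma measurable_open (U : set (borel M)) : @open M U -> measurable U.
Proof. by move=> oU; exact: sub_sigma_algebra. Qed.

Lemma continuous_measurable (f : M -> R) : continuous f ->
  measurable_fun [set: borel M] (f : borel M -> R).
Proof.
move=> /continuousP cf; apply: (measurability _ (RGenOpens.measurableE R)).
move=> _ [_ [a [b ->] <-]]; rewrite setTI; apply: measurable_open.
exact/cf/interval_open.
Qed.

Lemma open_cozero_measurable (U : set M) :
  hausdorff_space M -> compact [set: M] -> @second_countable M -> open U ->
  <<s [set [set x | 0 < h x] | h in [set h : M -> R | continuous h]] >> U.
Proof.
move=> hM cM [B cB [Bo Bb]] oU.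
have nM := compact_normal hM cM.
pose D := [set V | B V /\ closure V `<=` U].
have sep V : D V -> exists h : M -> R, [/\ continuous h,
    forall x, V x -> 0 < h x & forall x, 0 < h x -> U x].
  move=> [_ VU]; have /(_ (~` U) (closure V)) := (normal_separatorP (R := R)).1 nM.
  case/(_ (open_closedC oU) (@closed_closure _ _) _)/(uniform_separatorP (R := R)).
    by apply/disjoints_subset; exact: subsetC.
  move=> h [ch _ h0 h1]; exists h; split => // x.
    by move=> /subset_closure Vx; rewrite (h1 (h x)) ?ltr01//; exists x.
  by apply: contraPP => nUx; rewrite (h0 (h x)) ?ltxx//; exists x.
have {sep} /choice[h hP] : forall V : D, exists h : M -> R, [/\ continuous h,
    forall x, (val V) x -> 0 < h x & forall x, 0 < h x -> U x].
  by move=> V; apply: sep; exact: set_valP.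
have -> : U = \bigcup_V [set x | 0 < h V x].
  apply/seteqP; split => [x Ux|x [V _ hx]]; last by have [_ _] := hP V; apply.
  have [] : filter_from (nbhs x) closure U.
    have rM : {for x, regular_space M}.
      exact: (@compact_regular _ _ _ hM cM filterT).
    exact/rM/open_nbhs_nbhs.
  move=> W nW WU; have [V [BV Vx] VW] := Bb x W nW.
  have DV : D V by split => //; apply: subset_trans WU; exact: closureS.
  exists (SigSub (mem_set DV)) => //=.
  by have [_ + _] := hP (SigSub (mem_set DV)); apply.
apply: (@countable_bigcupT_measurable _ (g_sigma_algebraType
  [set [set x | 0 < h x] | h in [set h : M -> R | continuous h]])).
  rewrite (eq_countable (card_setT D)); apply: sub_countable cB.
  by apply: subset_card_le => V [].
by move=> V; apply: sub_sigma_algebra; exists (h V) => //; have [] := hP V.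
Qed.

End borel_of_cozero.

Section integral_functional.
Context (R : realType) (M : ptopologicalType).
Hypothesis cM : compact [set: M].

Lemma compact_continuous_bounded (f : M -> R) : continuous f ->
  exists2 K : R, 0 < K & forall x, `|f x| <= K.
Proof.
move=> cf; have := @continuous_compact _ _ f setT _ cM.
move=> /(_ (continuous_subspaceT cf))/compact_bounded/pinfty_ex_gt0[K K0 fK].
by exists K => // x; apply: fK; exists x.
Qed.

Lemma continuous_integrable (P : probability (borel M) R) (f : M -> R) :
  continuous f -> P.-integrable [set: borel M] (EFin \o f).
Proof.
move=> cf; apply: measurable_bounded_integrable => //.
- by apply: le_lt_trans (probability_le1 P measurableT) _; rewrite ltry.
- exact: continuous_measurable.
- have [K _ fK] := compact_continuous_bounded cf.
  exists K; split; first exact: num_real.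
  by move=> y Ky x _; apply: le_trans (fK x) (ltW Ky).
Qed.

Lemma integral_functional (P : probability (borel M) R) :
  positive_functional (fun f : M -> R => \int[P]_x f x).
Proof.
split => [f g cf cg|c f cf|f _ f0|].
- by rewrite RintegralD//; exact: continuous_integrable.
- by rewrite RintegralZl//; exact: continuous_integrable.
- by apply: Rintegral_ge0 => x _; exact: f0.
- by rewrite Rintegral_cst// mul1r (congr1 fine (@probability_setT _ _ _ P)).
Qed.

End integral_functional.

Section riesz.
Context (R : realType) (M : ptopologicalType) (L : (M -> R) -> R).
Hypotheses (hM : hausdorff_space M) (cM : compact [set: M]).
Hypotheses (scM : @second_countable M) (posL : positive_functional L).

Let mu := functional_outer_measure posL.

Let borel_caratheodory (A : set (borel M)) : measurable A ->
  mu.-caratheodory A.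
Proof.
apply: (@smallest_sub _ _ _ (measurable : set (set (caratheodory_type mu)))).
  exact: sigma_algebra_measurable.
move=> U oU; have := open_cozero_measurable (R := R) hM cM scM oU.
apply: (@smallest_sub _ _ _ (measurable : set (set (caratheodory_type mu)))).
  exact: sigma_algebra_measurable.
by move=> _ [h ch <-]; exact: cozero_caratheodory.
Qed.

Definition riesz_measure (A : set (borel M)) : \bar R := mu A.

Let riesz0 : riesz_measure set0 = 0%E.
Proof. exact: outer_measure0. Qed.

Let riesz_ge0 A : (0 <= riesz_measure A)%E.
Proof. exact: outer_measure_ge0. Qed.

Let riesz_sigma_additive : semi_sigma_additive riesz_measure.
Proof.
move=> F mF tF mUF; apply: (@caratheodory_measure_sigma_additive _ _ mu) => //.
  by move=> n; exact: borel_caratheodory.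
exact: borel_caratheodory.
Qed.

Let riesz_setT : riesz_measure setT = 1%E.
Proof.
have mE : riesz_measure setT = upper_integral L (EFin \o (fun=> 1%R)).
  by congr upper_integral; apply/funext => x; rewrite indicT.
apply/eqP; rewrite mE eq_le.
rewrite (le_trans (upper_integral_le posL _ _)) ?(functional_cst posL)//.
  rewrite -[X in (X%:E <= _)%E](functional_cst posL 1).
  by apply: upper_integral_ge => //; exact: cst_continuous.
exact: cst_continuous.
Qed.

HB.instance Definition _ := isMeasure.Build _ _ _ riesz_measure
  riesz0 riesz_ge0 riesz_sigma_additive.

HB.instance Definition _ := Measure_isProbability.Build _ _ _ riesz_measure
  riesz_setT.

Definition riesz_probability : probability (borel M) R := riesz_measure.

Let E (f : M -> R) := \int[riesz_probability]_x f x.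
Let posE : positive_functional E := integral_functional cM riesz_probability.

(* Cutting f into layers f_i of height 1/n.+1, the layer f_(i+1) is dominated by
   the indicator of a set on which f_i is maximal. *)
Let riesz_integral_le (f : M -> R) :
  continuous f -> (forall x, 0 <= f x <= 1) -> E f <= L f.
Proof.
move=> cf f01; apply/ler_addgt0Pr => e e0.
have [n] := ltr_add_invr e0; rewrite add0r => ne.
apply: (@le_trans _ _ (L f + n.+1%:R^-1)); last by rewrite lerD2l ltW.
pose N : R := n.+1%:R; have N0 : 0 < N by rewrite ltr0n.
pose g i x := Num.min (f x) (i.+1%:R / N) - Num.min (f x) (i%:R / N).
have cmin c : continuous (fun x => Num.min (f x) c).
  move=> x; apply: (@continuous_min _ _ f (fun=> c)); first exact: cf.
  exact: cvg_cst.
have cg i : continuous (g i) by move=> x; apply: cvgB; exact: cmin.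
have SN i : i.+1%:R / N = i%:R / N + N^-1 by rewrite -natr1 mulrDl mul1r.
have sumg x : \sum_(i < n.+1) g i x = f x.
  rewrite -(big_mkord xpredT (fun i => g i x)).
  rewrite (telescope_sumr (fun i => Num.min (f x) (i%:R / N)))//.
  have /andP[f0 f1] := f01 x.
  by rewrite mul0r divff ?gt_eqF// (min_l f1) (min_r f0) subr0.
have g_ge0 i x : 0 <= g i x.
  by rewrite /g SN subr_ge0 le_min !ge_min lexx/= lerDl invr_ge0 (ltW N0) orbT.
have g_le i x : g i x <= N^-1.
  have : 0 < N^-1 by rewrite invr_gt0.
  rewrite /g SN; move: (i%:R / N) (N^-1) => a c c0.
  by rewrite /Num.min; case: ltP => ?; case: ltP => ?; lra.
have step i : E (g i.+1) <= L (g i).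
  pose A : set (borel M) := [set x | i.+1%:R / N <= f x].
  have mA : measurable A.
    have := continuous_measurable cf measurableT (measurable_itv `[i.+1%:R / N, +oo[).
    rewrite setTI (_ : _ @^-1` _ = A)//.
    by apply/seteqP; split => x /=; rewrite in_itv/= andbT.
  have muA : (riesz_measure A <= (N * L (g i))%:E)%E.
    rewrite -(functionalZ posL)//; apply: le_trans (upper_integral_le posL _ _).
    - apply: le_upper_integral => x; rewrite lee_fin indicE.
      case: (boolP (x \in A)) => [/set_mem Ax|_]; last by rewrite mulr_ge0// ltW.
      rewrite /g (min_r Ax) min_r; last by rewrite (le_trans _ Ax)// SN lerDl invr_ge0 ltW.
      by rewrite SN addrAC subrr add0r divff ?gt_eqF.
    - by move=> x; apply: cvgM; [exact: cvg_cst|exact: cg].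
    - by move=> x; rewrite mulr_ge0// ltW.
  have : (\int[riesz_probability]_x (g i.+1 x)%:E <=
          \int[riesz_probability]_x (N^-1%:E * (\1_A x)%:E))%E.
    apply: ge0_le_integral => //=.
    - by move=> x _; rewrite lee_fin.
    - by apply/measurable_EFinP; exact: continuous_measurable.
    - apply/measurable_EFinP/measurable_funM => //; exact: measurable_indic.
    - move=> x _; rewrite -EFinM lee_fin indicE.
      case: (boolP (x \in A)) => [/set_mem Ax|]; first by rewrite mulr1.
      rewrite notin_setE mulr0 /A/= => /negP; rewrite -ltNge => fx.
      rewrite /g (min_l (ltW fx)) min_l ?subrr//.
      by rewrite (le_trans (ltW fx))// [leRHS]SN lerDl invr_ge0 ltW.
  rewrite ge0_integralZl//; last 2 first.
  - apply/measurable_EFinP; exact: measurable_indic.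
  - by rewrite lee_fin invr_ge0 ltW.
  rewrite integral_indic// setIT => le1.
  have : (\int[riesz_probability]_x (g i.+1 x)%:E <= (L (g i))%:E)%E.
    apply: le_trans le1 _; rewrite -lee_pdivlMl// ?invr_gt0// invrK.
    by rewrite -EFinM.
  rewrite -lee_fin; congr (_ <= _)%E; rewrite /E /Rintegral fineK//.
  by apply: integrable_fin_num => //; exact: continuous_integrable.
have -> : E f = \sum_(i < n.+1) E (g i).
  rewrite -(functional_sum posE)//; congr E; apply/funext => x.
  by rewrite sumg.
have -> : L f = \sum_(i < n.+1) L (g i).
  rewrite -(functional_sum posL)//; congr L; apply/funext => x.
  by rewrite sumg.
rewrite big_ord_recl big_ord_recr/= [leLHS]addrC lerD//.
  apply: (@le_trans _ _ (\sum_(i < n) L (g i))).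
    by apply: ler_sum => i _; exact: step.
  by rewrite lerDl functional_ge0.
rewrite -(functional_cst posE n.+1%:R^-1); apply: (le_functional posE) => //.
  exact: cst_continuous.
Qed.

Lemma riesz_integral (f : M -> R) : continuous f -> E f = L f.
Proof.
move=> cf; have [K K0 fK] := compact_continuous_bounded cM cf.
pose g x := (2 * K)^-1 * (f x + K).
have cg : continuous g.
  move=> x; apply: cvgM; first exact: cvg_cst.
  by apply: cvgD; [exact: cf|exact: cvg_cst].
have g01 x : 0 <= g x <= 1.
  have := fK x; rewrite ler_norml => /andP[f1 f2].
  rewrite /g mulrC ler_pdivrMr ?mulr_gt0// mul1r.
  by apply/andP; split; [apply: divr_ge0|]; lra.
have Eg : E g = L g.
  apply/eqP; rewrite eq_le riesz_integral_le//=.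
  have : E (fun x => 1 - g x) <= L (fun x => 1 - g x).
    apply: riesz_integral_le => [x|x].
      by apply: cvgB; [exact: cvg_cst|exact: cg].
    by have := g01 x; lra.
  rewrite (functionalB posE)//; last exact: cst_continuous.
  rewrite (functionalB posL)//; last exact: cst_continuous.
  by rewrite (functional_cst posE) (functional_cst posL) lerD2l lerN2.
have -> : f = fun x => 2 * K * g x + - K.
  by apply/funext => x; rewrite /g mulrA divff ?mul1r ?addrK// gt_eqF// mulr_gt0.
rewrite (functionalD posE); [|by move=> x; apply: cvgM; [exact: cvg_cst|exact: cg]|
  exact: cst_continuous].
rewrite (functionalD posL); [|by move=> x; apply: cvgM; [exact: cvg_cst|exact: cg]|
  exact: cst_continuous].
rewrite (functional_cst posE) (functional_cst posL).
by rewrite (functionalZ posE)// (functionalZ posL)// Eg.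
Qed.

End riesz.

Lemma strictly_increasing_choice (Q : nat -> nat -> Prop) :
  (forall k N, exists2 n, (N <= n)%N & Q k n) ->
  exists2 s : nat -> nat, {homo s : i j / (i < j)%N} & forall k, Q k (s k).
Proof.
move=> Qex; have /choice[g gP] : forall kN, exists n, (kN.2 <= n)%N /\ Q kN.1 n.
  by move=> [k N]; have [n Nn Qn] := Qex k N; exists n.
pose s := fix s k := if k is k'.+1 then g (k, (s k').+1) else g (0%N, 0%N).
exists s; last first.
  by case=> [|k]; [have [] := gP (0%N, 0%N)|have [] := gP (k.+1, (s k).+1)].
apply: homo_ltn => [y x z xy yz|k]; first exact: ltn_trans xy yz.
by have [] := gP (k.+1, (s k).+1).
Qed.

Lemma increasing_ge_id (s : nat -> nat) :
  {homo s : i j / (i < j)%N} -> forall k, (k <= s k)%N.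
Proof.
move=> sh; elim=> // k IH; exact: leq_ltn_trans IH (sh _ _ (ltnSn k)).
Qed.

Lemma ultra_bounded_cvg (R : realType) (I : Type) (F : set_system I)
    (FU : UltraFilter F) (u : I -> R) (K : R) :
  (forall i, `|u i| <= K) -> exists l : R, u i @[i --> F] --> l.
Proof.
move=> uK; have FP : ProperFilter F by exact: ultra_proper.
have uFK : (u @ F) `[-K, K]%classic.
  apply: (@filterE _ F _ (u @^-1` `[-K, K]%classic)) => i.
  by rewrite /= in_itv/= -ler_norml.
have [l [_ lF]] := @segment_compact R (-K) K (u @ F) _ uFK.
exists l => A lA; have [//|nFA] := in_ultra_setVsetC (u @^-1` A) FU.
by have [x [nAx Ax]] := lF (~` A) A nFA lA.
Qed.

Section weak_star_convergence.
Context (R : realType) (M : ptopologicalType).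

Lemma weak_star_cvgP (I : Type) (F : set_system I) (FF : Filter F)
    (P : I -> probability (borel M) R) (nu : probability (borel M) R) :
  (P i : weak_star R M) @[i --> F] --> (nu : weak_star R M) <->
  (forall phi : M -> R, continuous phi ->
     \int[P i]_x phi x @[i --> F] --> \int[nu]_x phi x).
Proof.
split=> [PF phi cphi|PF].
  pose c : continuousType M R := HB.pack phi (isContinuous.Build _ _ phi cphi).
  have cti := @initial_continuous _ _ (@test_integrals R M) nu.
  have TF : test_integrals (P i) @[i --> F] --> test_integrals nu.
    exact: cvg_comp PF cti.
  exact: cvg_comp TF (@proj_continuous _ (fun=> R : topologicalType) c _).
have TF : test_integrals (P i) @[i --> F] --> test_integrals nu.
  apply/cvg_sup => c U [_ [[W oW <-] Wnu WU]].
  apply: (filterS WU); apply: PF (open_nbhs_nbhs (conj oW Wnu)).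
  exact: cts_fun.
move=> A [_ [[B oB <-] Bnu BA]].
by apply: (filterS BA); exact: TF (open_nbhs_nbhs (conj oB Bnu)).
Qed.

Variable dist : probability (borel M) R -> probability (borel M) R -> R.
Hypothesis distP : is_weak_star_metric dist.

Lemma dist_ball_nbhs (nu : probability (borel M) R) (e : R) : 0 < e ->
  nbhs (nu : weak_star R M) [set xi | dist nu xi < e].
Proof. by case: distP => _ _ _ D e0; apply/D; exists e. Qed.

Hypotheses (hM : hausdorff_space M) (cM : compact [set: M]).
Hypothesis scM : @second_countable M.

Lemma weak_star_sequentially_compact (P : nat -> probability (borel M) R) :
  exists nu, exists2 s : nat -> nat, {homo s : i j / (i < j)%N} &
    (fun k => P (s k) : weak_star R M) @ \oo --> (nu : weak_star R M).
Proof.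
have [F [FU ooF]] := @ultraFilterLemma nat \oo _.
have FP : ProperFilter F by exact: ultra_proper.
pose E n (f : M -> R) := \int[P n]_x f x.
have posE n : positive_functional (E n) by exact: integral_functional.
have lim_ex (f : M -> R) : exists l : R, continuous f -> E n f @[n --> F] --> l.
  have [cf|] := pselect (continuous f); last by exists 0.
  have [K K0 fK] := compact_continuous_bounded cM cf.
  suff [l lF] : exists l : R, E n f @[n --> F] --> l by exists l.
  apply: (ultra_bounded_cvg FU (K := K)) => n; rewrite ler_norml.
  rewrite -(functional_cst (posE n) (- K)) -[X in _ <= _ <= X](functional_cst (posE n) K).
  apply/andP; split; apply: (le_functional (posE n)) => //; try exact: cst_continuous.
    by move=> x; have := fK x; rewrite ler_norml => /andP[].
  by move=> x; have := fK x; rewrite ler_norml => /andP[].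
have [L LP] := choice lim_ex.
have Luniq (f : M -> R) l : continuous f -> E n f @[n --> F] --> l -> L f = l.
  by move=> cf; apply: norm_cvg_unique; exact: LP.
have posL : positive_functional L.
  split=> [f g cf cg|c f cf|f cf f0|].
  - apply: Luniq => [x|]; first by apply: cvgD; [exact: cf|exact: cg].
    rewrite (_ : (fun n => _) = (fun n => E n f + E n g)).
      by apply: cvgD; exact: LP.
    by apply/funext => n; exact: (functionalD (posE n)).
  - apply: Luniq => [x|]; first by apply: cvgM; [exact: cvg_cst|exact: cf].
    under eq_fun do rewrite (functionalZ (posE _) c cf).
    by apply: cvgM; [exact: cvg_cst|exact: LP].
  - apply: (@closed_cvg _ R F FP (E ^~ f) (fun y => 0 <= y) _ _ _ (LP f cf)).
      exact: closed_ge.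
    by apply: nearW => n; exact: (functional_ge0 (posE n)).
  - apply: Luniq => [x|]; first exact: cvg_cst.
    under eq_fun do rewrite (functional_cst (posE _)).
    exact: cvg_cst.
pose nu := riesz_probability hM cM scM posL.
have PF : (P n : weak_star R M) @[n --> F] --> (nu : weak_star R M).
  by apply/weak_star_cvgP => f cf; rewrite riesz_integral//; exact: LP.
have near_nu k N : exists2 n, (N <= n)%N & dist nu (P n) < k.+1%:R^-1.
  have Fk : F [set n | dist nu (P n) < k.+1%:R^-1].
    by apply: (PF [set xi | dist nu xi < k.+1%:R^-1]); exact: dist_ball_nbhs.
  have FN : F [set n | (N <= n)%N] by apply: ooF; exact: nbhs_infty_ge.
  by have [n [nk Nn]] := filter_ex (filterI Fk FN); exists n.
have [s sh sP] := strictly_increasing_choice near_nu.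
exists nu, s => // A; case: distP => _ _ _ D /D[e e0 eA].
have [k ke] := ltr_add_invr e0; rewrite add0r in ke.
exists k => // j /= kj; apply: eA => /=; apply: lt_le_trans (sP j) _.
by apply: le_trans (ltW ke); rewrite lef_pV2 ?posrE// ler_nat.
Qed.

End weak_star_convergence.

Section empirical_measures.
Context (R : realType) (M : ptopologicalType) (f : M -> M).
Hypotheses (hM : hausdorff_space M) (cM : compact [set: M]).
Hypotheses (scM : @second_countable M) (cf : continuous f).

Notation emp x n := (empirical R f x n : probability (borel M) R).

Lemma empirical_integral_ge0 x n (phi : M -> R) :
  continuous phi -> (forall y, 0 <= phi y) ->
  \int[emp x n]_y phi y = n.+1%:R^-1 * \sum_(j < n.+1) phi (iter j f x).
Proof.
move=> cphi phi0.
have mphi : measurable_fun [set: borel M] (EFin \o phi).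
  by apply/measurable_EFinP; exact: continuous_measurable.
rewrite /Rintegral ge0_integral_mscale//=; last by move=> y _; rewrite lee_fin.
rewrite ge0_integral_measure_sum//; last by move=> y _; rewrite lee_fin.
rewrite (eq_bigr (fun j : 'I_n.+1 => (phi (iter j f x))%:E)); last first.
  by move=> j _; rewrite integral_dirac// diracT mul1e.
by rewrite sumEFin -EFinM.
Qed.

Lemma empirical_integral x n (phi : M -> R) : continuous phi ->
  \int[emp x n]_y phi y = n.+1%:R^-1 * \sum_(j < n.+1) phi (iter j f x).
Proof.
move=> cphi; have [K K0 phiK] := compact_continuous_bounded cM cphi.
have posE := integral_functional cM (emp x n).
have := @empirical_integral_ge0 x n (fun y => phi y + K).
rewrite (functionalD posE)//; last exact: cst_continuous.
rewrite (functional_cst posE) big_split/= mulrDr sumr_const card_ord.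
rewrite -[K *+ _]mulr_natl mulKf// => E; apply: (addIr K); apply: E.
  by move=> y; apply: cvgD; [exact: cphi|exact: cvg_cst].
by move=> y; have := phiK y; rewrite ler_norml => /andP[+ _]; rewrite -subr_ge0 opprK.
Qed.

Lemma iter_continuous j : continuous (iter j f).
Proof.
elim: j => [|j IH] x; first exact: cvg_id.
by apply: (@continuous_comp _ _ _ (iter j f) f); [exact: IH|exact: cf].
Qed.

Lemma empirical_continuous n :
  continuous (fun x => emp x n : weak_star R M).
Proof.
move=> x; apply/weak_star_cvgP => phi cphi.
under eq_fun do rewrite empirical_integral//.
rewrite empirical_integral//; apply: cvgM; first exact: cvg_cst.
apply: (@continuous_fsum _ _ n.+1 (fun j y => phi (iter j f y))) => j y.
apply: (@continuous_comp _ _ _ (iter j f) phi); first exact: iter_continuous.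
exact: cphi.
Qed.

Variable dist : probability (borel M) R -> probability (borel M) R -> R.
Hypothesis distP : is_weak_star_metric dist.

Lemma open_empirical_ball mu n r : open [set x | dist mu (emp x n) < r].
Proof.
have nbhs_open (A : set M) : (forall x, A x -> nbhs x A) -> open A.
  by rewrite openE.
apply: nbhs_open => x /= xr; have [_ _ tri _] := distP.
have e0 : 0 < r - dist mu (emp x n) by rewrite subr_gt0.
have := @empirical_continuous n x _ (dist_ball_nbhs distP (emp x n) e0).
apply: (@filterS _ (nbhs x)) => y /= yx.
by apply: le_lt_trans (tri _ (emp x n) _) _; rewrite -ltrBrDl.
Qed.

(* A limit of empirical measures at distance at least e - 1/(k+1) from mu for
   every k would be a limit measure outside of the ball of radius e. *)
Lemma observation_setE mu e : observation_set f dist mu e =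
  \bigcup_k \bigcup_N \bigcap_(n in [set n | (N <= n)%N])
    [set x | dist mu (emp x n) < e - k.+1%:R^-1].
Proof.
have [_ dC tri _] := distP.
apply/seteqP; split => x.
  move=> obs; apply: contrapT => nx.
  have far k N : exists2 n, (N <= n)%N & e - k.+1%:R^-1 <= dist mu (emp x n).
    apply: contrapT => nfar; apply: nx; exists k => //; exists N => // n /= Nn.
    by rewrite ltNge; apply/negP => ?; apply: nfar; exists n.
  have [t th tP] := strictly_increasing_choice far.
  have [nu [s sh sP]] :=
    weak_star_sequentially_compact distP hM cM scM (fun k => emp x (t k)).
  have nu_e : dist mu nu < e.
    by apply: obs; exists (t \o s) => // i j ij; exact/th/sh.
  have d0 : 0 < (e - dist mu nu) / 2 by rewrite divr_gt0// subr_gt0.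
  have [k0] := ltr_add_invr d0; rewrite add0r => k0P.
  have [k1 _ k1P] := sP _ (dist_ball_nbhs distP nu d0).
  pose k := maxn k0 k1.
  have /= near_nu := k1P k (leq_maxr _ _).
  have := tP (s k); apply/negP; rewrite -ltNge.
  apply: le_lt_trans (tri _ nu _) _.
  have : (s k).+1%:R^-1 <= k0.+1%:R^-1 :> R.
    rewrite lef_pV2 ?posrE// ler_nat ltnS (leq_trans (leq_maxl k0 k1))//.
    exact: increasing_ge_id.
  move: k0P near_nu; set a := dist mu nu; set b := dist nu _.
  by move: (k0.+1%:R^-1) ((s k).+1%:R^-1) => u v; lra.
move=> [k _ [N _ xN]] nu [s sh sP] /=.
have k0 : 0 < k.+1%:R^-1 :> R by rewrite invr_gt0.
have [j0 _ j0P] := sP _ (dist_ball_nbhs distP nu k0).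
pose j := maxn N j0.
have /= near_nu := j0P j (leq_maxr _ _).
have /= xj := xN (s j) (leq_trans (leq_maxl N j0) (increasing_ge_id sh j)).
apply: le_lt_trans (tri _ (emp x (s j)) _) _.
rewrite (dC _ nu); move: xj near_nu.
set a := dist mu _; set b := dist nu _.
by move: (k.+1%:R^-1) => u; lra.
Qed.

Lemma measurable_observation_set mu e : measurable (observation_set f dist mu e).
Proof.
rewrite observation_setE; apply: bigcupT_measurable => k.
apply: bigcupT_measurable => N; apply: bigcap_measurable => [|n _]; first by exists N => /=.
by apply: measurable_open; exact: open_empirical_ball.
Qed.

Lemma observation_set_near mu e x : observation_set f dist mu e x ->
  \forall n \near \oo, dist mu (emp x n) < e.
Proof.
rewrite observation_setE => -[k _ [N _ xN]]; exists N => // n Nn.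
by apply: lt_trans (xN n Nn) _; rewrite ltrBlDr ltrDl invr_gt0.
Qed.

End empirical_measures.

Lemma limn_esup_le_near (R : realType) (u : (\bar R)^nat) (b : \bar R) :
  (\forall n \near \oo, (u n <= b)%E) -> (limn_esup u <= b)%E.
Proof.
move=> [n0 _ ub]; rewrite limn_esup_lim; apply: lime_le; first exact: is_cvg_esups.
exists n0 => // n /= n0n; apply: ge_ereal_sup => _ [k /= nk <-].
by apply: ub => /=; exact: leq_trans n0n nk.
Qed.

Lemma limn_einf_le (R : realType) (u : (\bar R)^nat) (b : \bar R) :
  (forall n, (u n <= b)%E) -> (limn_einf u <= b)%E.
Proof.
move=> ub; apply: le_trans (limn_einf_sup _) _.
by apply: limn_esup_le_near; exact: nearW.
Qed.

Section subadditive_potential_theory.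
Context (R : realType) (M : topologicalType) (f : M -> M) (phi : nat -> M -> R).
Hypothesis subphi : subadditive_potential f phi.
Variable C : R.
Hypotheses (C0 : 0 <= C) (phi1 : forall x, phi 1%N x <= C).

Lemma subadditive_linear_bound n x : (0 < n)%N -> phi n x <= n%:R * C.
Proof.
case: subphi => _ sub; elim: n => // -[_ _|n IH _].
  by rewrite mul1r.
rewrite -addn1; apply: le_trans (sub _ _ _ _ _) _ => //.
by rewrite natrD mulrDl mul1r lerD// IH.
Qed.

(* From n to n + 1 the left side grows by phi_(n+1+N) - phi_(n+1), which is at
   most the growth phi_N o f^(n+1) of the right side. *)
Lemma subadditive_telescope N n x : (0 < N)%N ->
  \sum_(i < N) phi (n + i).+1 x <=
  \sum_(i < N) phi i.+1 x + \sum_(j < n) phi N (iter j.+1 f x).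
Proof.
case: subphi => _ sub; case: N => // N _; elim: n => [|n IH].
  by rewrite [X in _ + X]big_ord0 addr0; under eq_bigr do rewrite add0n.
rewrite [X in _ + X]big_ord_recr/= addrA.
apply: le_trans (lerD IH (lexx _)).
rewrite [leLHS]big_ord_recr [X in _ <= X + _]big_ord_recl/=.
rewrite addn0 -addrA [leRHS]addrCA lerD//.
  by apply: ler_sum => i _; rewrite /bump/= add1n addSnnS.
by have := sub n.+1 N.+1 x isT isT; rewrite addnS.
Qed.

Lemma subadditive_birkhoff_bound N n x : (0 < N)%N ->
  N%:R * phi (n + N).+1 x <=
  2 * (N%:R * (N%:R * C)) + \sum_(j < n) phi N (iter j.+1 f x).
Proof.
case: subphi => _ sub N0.
have NC0 : 0 <= N%:R * C by rewrite mulr_ge0.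
have le_NC k y : (0 < k <= N)%N -> phi k y <= N%:R * C.
  case/andP=> k0 kN; apply: le_trans (subadditive_linear_bound y k0) _.
  by rewrite ler_wpM2r// ler_nat.
have -> : N%:R * phi (n + N).+1 x = \sum_(i < N) phi (n + N).+1 x.
  by rewrite sumr_const card_ord mulr_natl.
have sumC : \sum_(i < N) (N%:R * C) = N%:R * (N%:R * C).
  by rewrite sumr_const card_ord -[LHS]mulr_natl.
apply: (@le_trans _ _ (\sum_(i < N) (phi (n + i).+1 x + N%:R * C))).
  apply: ler_sum => i _; have iN := ltn_ord i.
  have -> : (n + N).+1 = ((n + i).+1 + (N - i))%N by rewrite addSn -addnA subnKC// ltnW.
  apply: le_trans (sub _ _ _ _ _) _ => //; first by rewrite subn_gt0.
  by rewrite lerD2l le_NC// subn_gt0 iN leq_subr.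
have first_le : \sum_(i < N) phi i.+1 x <= N%:R * (N%:R * C).
  by rewrite -sumC; apply: ler_sum => i _; apply: le_NC; rewrite /= ltn_ord.
rewrite big_split/= sumC; have := subadditive_telescope n x N0; move: first_le.
by move: (\sum_(i < N) phi i.+1 x) (N%:R * (N%:R * C)) => a b; lra.
Qed.

Lemma birkhoff_growth N x (K c : R) : (0 < N)%N ->
  (forall y, `|phi N y| <= K) -> 0 < c ->
  (\forall n \near \oo,
     \sum_(j < n.+1) phi N (iter j f x) <= - c * n.+1%:R) ->
  (largest_growth_rate phi x < 0)%E.
Proof.
move=> N0 phiK c0 [n0 _ sum_le].
have NR0 : 0 < N%:R :> R by rewrite ltr0n.
pose D := 2 * (N%:R * (N%:R * C)) + K + c * N%:R.
apply: (@le_lt_trans _ _ (- (c / 2 / N%:R))%:E); last first.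
  by rewrite lte_fin oppr_lt0 divr_gt0// divr_gt0.
apply: limn_esup_le_near; near=> m.
have n0m : (n0 + N.+1 <= m)%N by near: m; exact: nbhs_infty_ge.
have Dm : 2 * D / c <= m%:R by near: m; exact: nbhs_infty_ger.
have [n mE n0n] : exists2 n, m = (n + N).+1 & (n0 <= n)%N.
  exists (m - N.+1)%N; last by rewrite -(leq_add2r N.+1) subnK// (leq_trans (leq_addl _ _) n0m).
  by rewrite -addnS subnK// (leq_trans (leq_addl _ _) n0m).
have m0 : 0 < m%:R :> R by rewrite mE ltr0n.
rewrite /growth lee_fin ler_pdivrMr// -(ler_pM2l NR0).
have -> : N%:R * (- (c / 2 / N%:R) * m%:R) = - (c * m%:R / 2).
  by field; rewrite gt_eqF.
have := subadditive_birkhoff_bound n x N0; rewrite -mE.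
have := sum_le n n0n; rewrite /= big_ord_recl/=.
have := phiK x; rewrite ler_norml => /andP[+ _].
have -> : n.+1%:R = m%:R - N%:R :> R by rewrite mE -addSn natrD addrK.
move: Dm; rewrite ler_pdivrMr// /D.
move: (\sum_(j < n) _) (N%:R * phi m x) (phi N x) (N%:R * (N%:R * C)) => u v w z.
move: (m%:R) (N%:R) => p q; lra.
Unshelve. all: by end_near. Qed.

End subadditive_potential_theory.

Section negative_mean.
Context (R : realType) (M : ptopologicalType) (f : M -> M) (phi : nat -> M -> R).
Hypotheses (cM : compact [set: M]) (subphi : subadditive_potential f phi).

Lemma measurable_growth n : measurable_fun [set: borel M]
  ((fun x => growth phi x n) : borel M -> \bar R).
Proof.
apply/measurable_EFinP; case: n => [|n].
  rewrite (_ : (fun x => _) = cst 0); last first.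
    by apply/funext => x; rewrite invr0 mulr0.
  exact: measurable_cst.
apply: measurable_funM => //; apply: continuous_measurable.
by case: subphi => + _; exact.
Qed.

(* Reverse Fatou: phi_n/n is bounded above, so limsup of the integrals of
   phi_n/n is at most the integral of the limit; this needs no invariance. *)
Lemma negative_mean (mu : probability (borel M) R) :
  {ae mu, forall x : borel M, exists2 l : \bar R,
     growth phi x @ \oo --> l & (l < 0)%E} ->
  exists2 N, (0 < N)%N & \int[mu]_x phi N x < 0.
Proof.
move=> ae_neg; apply: contrapT => nneg.
have cphi n : continuous (phi n.+1) by case: subphi => + _; exact.
have int_ge0 n : 0 <= \int[mu]_x phi n.+1 x.
  by rewrite leNgt; apply/negP => ?; apply: nneg; exists n.+1.
have [C C0 phiC] := compact_continuous_bounded cM (cphi 0%N).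
have phi_le n x : phi n.+1 x <= n.+1%:R * C.
  apply: (subadditive_linear_bound subphi) => // y.
  exact: le_trans (ler_norm _) (phiC y).
pose F n (x : borel M) : \bar R := (C%:E - growth phi x n.+1)%E.
have F0 n x : (0 <= F n x)%E.
  by rewrite /F /growth -EFinB lee_fin subr_ge0 ler_pdivrMr// mulrC.
have mF n : measurable_fun [set: borel M] (F n).
  by apply: emeasurable_funB => //; exact: measurable_growth.
pose g x := limn_einf (F ^~ x).
have gE : g = (fun x => - limn_esup (fun n => - F n x))%E.
  by apply/funext => x; rewrite /g -[LHS]oppeK -limn_esupN.
have mg : measurable_fun [set: borel M] g.
  rewrite gE; apply/measurableT_comp => //; apply: measurable_fun_limn_esup => n.
  exact: measurableT_comp.
have int_g : (\int[mu]_x g x <= C%:E)%E.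
  apply: le_trans (fatou mu measurableT mF _) _ => //.
  apply: limn_einf_le => n; pose u (x : M) := C - n.+1%:R^-1 * phi n.+1 x.
  have cv : continuous (fun x => n.+1%:R^-1 * phi n.+1 x).
    by move=> x; apply: cvgM; [exact: cvg_cst|exact: cphi].
  have cu : continuous u by move=> x; apply: cvgB; [exact: cvg_cst|exact: cv].
  have posE := integral_functional cM mu.
  have Eu : \int[mu]_x u x <= C.
    rewrite (functionalB posE)//; last exact: cst_continuous.
    rewrite (functional_cst posE) (functionalZ posE)// gerBl.
    by rewrite mulr_ge0// invr_ge0.
  rewrite (_ : F n = EFin \o u); last first.
    by apply/funext => x; rewrite /F /growth /u -EFinB mulrC.
  rewrite -lee_fin in Eu; apply: le_trans Eu; rewrite /Rintegral fineK//.
  by apply: integrable_fin_num => //; exact: continuous_integrable.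
pose h x := maxe (g x - C%:E)%E 0%E.
have mh : measurable_fun [set: borel M] h.
  apply: measurable_maxe => //; exact: emeasurable_funB.
have h0 x : (0 <= h x)%E by rewrite /h le_max lexx orbT.
have g0 x : (0 <= g x)%E.
  rewrite gE oppe_ge0; apply: limn_esup_le_near; apply: nearW => n.
  by rewrite oppe_le0.
have ae_g : {ae mu, forall x : borel M, (C%:E < g x)%E}.
  apply: filterS ae_neg => x [l xl l0].
  have Fl : F n x @[n --> \oo] --> (C%:E - l)%E.
    apply: cvgeB => //; first exact: cvg_cst.
    by rewrite (cvg_shiftS (growth phi x)).
  rewrite /g (cvg_limn_einf_sup Fl).1.
  by case: l l0 {xl Fl} => //= [r|] r0; rewrite ?ltry// -EFinB lte_fin ltrDl oppr_gt0.
have int_h : (\int[mu]_x h x <= 0)%E.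
  rewrite -(@leeD2lE _ C%:E)// adde0; apply: le_trans int_g.
  rewrite -[X in (X + _)%E]mule1 -(probability_setT mu) -integral_cst//.
  rewrite -ge0_integralD//; last by move=> x _; rewrite lee_fin ltW.
  rewrite le_eqVlt; apply/orP; left; apply/eqP.
  apply: ge0_ae_eq_integral => //.
  - by apply: emeasurable_funD.
  - by move=> x _; rewrite adde_ge0// lee_fin ltW.
  - apply: filterS ae_g => x Cg _.
    have gC : (0 <= g x - C%:E)%E by rewrite sube_ge0// ltW.
    by rewrite /h max_l// [LHS]addeC subeK.
have ae_h : ae_eq mu setT h (cst 0%E).
  apply/ae_eq_integral_abs => //; apply/eqP; rewrite eq_le integral_ge0// andbT.
  by under eq_integral do rewrite gee0_abs//.
have : {ae mu, forall x : borel M, False}.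
  move: ae_g ae_h; apply: filterS2 => x Cg /(_ I) hx0.
  have : (0 < h x)%E by rewrite /h lt_max sube_gt0 Cg.
  by rewrite hx0 ltxx.
case=> A [mA A0 sA]; have AT : A = setT by apply/seteqP; split => // x _; apply: sA => /=.
have := probability_setT mu; rewrite -AT A0 => /eqP.
by rewrite eq_sym onee_eq0.
Qed.

End negative_mean.

Theorem corollary3p1 (R : realType) (d : nat) (M : ptopologicalType)
    (atlas : set (chart R d M)) (m : probability (borel M) R)
    (dist : probability (borel M) R -> probability (borel M) R -> R)
    (f : M -> M) (phi : nat -> M -> R) (mu : probability (borel M) R) :
  is_manifold atlas ->
  compact [set: M] ->
  is_normalized_lebesgue atlas m ->
  is_weak_star_metric dist ->
  continuous f ->
  subadditive_potential f phi ->
  strong_observable f dist m mu ->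
  {ae mu, forall x : borel M, exists2 l : \bar R,
     growth phi x @ \oo --> l & (l < 0)%E} ->
  (0 < m [set x : borel M | (largest_growth_rate phi x < 0)%E])%E.
Proof.
move=> [hM scM _ _ _] cM _ distP cf subphi obs_mu ae_neg.
have [N N0 mean_neg] := negative_mean cM subphi ae_neg.
have cphi n : (0 < n)%N -> continuous (phi n) by case: subphi => + _; exact.
pose I := \int[mu]_x phi N x.
have near_mu : nbhs (mu : weak_star R M)
    [set nu : probability (borel M) R | \int[nu]_x phi N x < I / 2].
  have := (@weak_star_cvgP R M _ (nbhs (mu : weak_star R M)) _ id mu).1 cvg_id.
  move=> /(_ _ (phi N) (cphi N N0)) /cvgr_lt; apply.
  by move: mean_neg; rewrite -/I; lra.
have [_ _ _ D] := distP; have [e e0 eI] := (D mu _).1 near_mu.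
have obs_neg : observation_set f dist mu e `<=`
    [set x : borel M | (largest_growth_rate phi x < 0)%E].
  move=> x /(observation_set_near hM cM scM distP) near_x.
  have [C C0 phiC] := compact_continuous_bounded cM (cphi 1%N isT).
  have [K _ phiK] := compact_continuous_bounded cM (cphi N N0).
  apply: (birkhoff_growth subphi (ltW C0) _ N0 phiK (c := - I / 2)).
  - by move=> y; exact: le_trans (ler_norm _) (phiC y).
  - by rewrite divr_gt0// oppr_gt0.
  apply: filterS near_x => n /eI /=.
  rewrite empirical_integral//; last exact: cphi.
  by rewrite mulrC ltr_pdivrMr// => /ltW; rewrite [- I / 2]mulNr opprK.
apply: lt_le_trans (obs_mu e e0) _; apply: le_measure => //; rewrite inE.
  exact: measurable_observation_set.
have := emeasurable_fun_infty_o measurableT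
  (measurable_fun_limn_esup (measurable_growth subphi)) 0%E.
by rewrite setTI.
Qed.
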